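(* For every integer $n\ge 4$ and every nonnegative function $f:\mathbb Z_n\to\mathbb R$, $$\operatorname{Ent}_\pi(f^2)\le 2\,\mathcal E_n(f).$$ The constant $2$ is sharp: for every $n\ge4$ and every real $c<2$ there is a nonnegative $f:\mathbb Z_n\to\mathbb R$ with $\operatorname{Ent}_\pi(f^2)> c\,\mathcal E_n(f)$.
   Context: $\mathbb Z_n=\mathbb Z/n\mathbb Z$ with the uniform probability measure $\pi$; for a function $f$ on $\mathbb Z_n$ write $\pi(f)=\frac1n\sum_{x\in\mathbb Z_n}f(x)$. For $g\ge0$ on $\mathbb Z_n$, $\operatorname{Ent}_\pi(g)=\pi(g\log g)-\pi(g)\log\pi(g)$, with the convention $0\log 0=0$. Fourier coefficients: $\widehat f(k)=\frac1n\sum_{x\in\mathbb Z_n}f(x)e^{-2\pi i kx/n}$. The word length is $\psi_n(k)=\min(k,n-k)$ for $k\in\{0,\dots,n-1\}$. The word-length Laplacian $A_{\psi_n}$ is the Fourier multiplier $A_{\psi_n}f(x)=\sum_{k=0}^{n-1}\psi_n(k)\widehat f(k)e^{2\pi i kx/n}$, and the Dirichlet form is $\mathcal E_n(f)=\pi(\overline f\,A_{\psi_n}f)=\sum_{k=0}^{n-1}\psi_n(k)|\widehat f(k)|^2$. *)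

(* Defs.v *)
From mathcomp Require Import all_boot all_order all_algebra.
From mathcomp Require Import reals exp trigo.
From mathcomp Require Export complex.

Set Implicit Arguments.
Unset Strict Implicit.
Unset Printing Implicit Defensive.

Import Order.TTheory GRing.Theory Num.Theory.
Local Open Scope ring_scope.
Local Open Scope complex_scope.

(* Everything below is meant for [1 < n]: ['Z_n] is the ring of residues mod n
   only then. *)

Definition mean (K : fieldType) (n : nat) (g : 'Z_n -> K) : K :=
  n%:R^-1 * \sum_(x : 'Z_n) g x.

(* [ln 0 = 0] in the library; the product is 0 where [g x = 0] in any case. *)
Definition entropy (R : realType) (n : nat) (g : 'Z_n -> R) : R :=
  mean (fun x => g x * ln (g x)) - mean g * ln (mean g).

Definition expi (R : realType) (t : R) : R[i] := cos t +i* sin t.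

Definition fourier_coef (R : realType) (n : nat) (f : 'Z_n -> R[i]) (k : nat)
    : R[i] :=
  n%:R^-1 * \sum_(x : 'Z_n)
    f x * expi (- (2%:R * pi * k%:R * (x : nat)%:R / n%:R)).

Definition word_length (n k : nat) : nat := minn k (n - k).

Definition word_laplacian (R : realType) (n : nat) (f : 'Z_n -> R[i])
    (x : 'Z_n) : R[i] :=
  \sum_(k < n) (word_length n k)%:R * fourier_coef f k *
    expi (2%:R * pi * k%:R * (x : nat)%:R / n%:R).

(* The mean is a nonnegative real number (see [mean_word_laplacian]); [Re] only
   brings it from [R[i]] to [R]. *)
Definition dirichlet_form (R : realType) (n : nat) (f : 'Z_n -> R[i]) : R :=
  complex.Re (mean (fun x => (f x)^* * word_laplacian f x)).

Lemma mulr_rot5 (K : comPzRingType) (a b c d e : K) :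
  a * (b * (c * d * e)) = c * (d * (a * (b * e))).
Proof.
rewrite [in RHS](mulrCA d a) (mulrCA c a); congr (_ * _).
by rewrite (mulrCA d b) (mulrCA c b) -mulrA.
Qed.

Lemma mean_word_laplacian (R : realType) (n : nat) (f : 'Z_n -> R[i]) :
  mean (fun x => (f x)^* * word_laplacian f x) =
  \sum_(k < n) (word_length n k)%:R * `|fourier_coef f k| ^+ 2.
Proof.
rewrite /mean /word_laplacian.
under eq_bigr do rewrite mulr_sumr.
rewrite exchange_big mulr_sumr; apply: eq_bigr => k _ /=.
rewrite sqr_normc.
have -> : (fourier_coef f k)^* = n%:R^-1 * \sum_(x : 'Z_n)
    (f x)^* * expi (2%:R * pi * k%:R * (x : nat)%:R / n%:R).
  rewrite /fourier_coef rmorphM /= fmorphV rmorph_nat rmorph_sum /=.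
  congr (_ * _); apply: eq_bigr => x _.
  by rewrite rmorphM; congr (_ * _); rewrite /expi /= cosN sinN opprK.
rewrite !mulr_sumr; apply: eq_bigr => x _.
exact: mulr_rot5.
Qed.

Lemma dirichlet_formE (R : realType) (n : nat) (f : 'Z_n -> R[i]) :
  (dirichlet_form f)%:C = mean (fun x => (f x)^* * word_laplacian f x).
Proof.
rewrite /dirichlet_form RRe_real // mean_word_laplacian ger0_real //.
by apply: sumr_ge0 => k _; rewrite mulr_ge0 ?ler0n ?exprn_ge0.
Qed.

(* Main.v *)
Require Import Defs.
From mathcomp Require Import all_boot all_order all_algebra.
From mathcomp Require Import zify ring lra.
From mathcomp Require Import classical_sets reals topology normedtype derive.
From mathcomp Require Import realfun exp trigo.

(* Upper bound.  By x^2 ln x^2 <= 2/3 x^3 + x^2 - 2x + 1/3 for x >= 0, applied to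
   f / a with a^2 = pi(f^2), the entropy of f^2 is at most
   2/3 pi(f^3) / a + 4/3 a^2 - 2 a pi(f).  Write f = m + g with m = pi(f) and let
   s = pi(g^2) = a^2 - m^2.  In Fourier space pi(g^3) is at most the sum of
   a_j a_k a_l over the triples j + k + l = 0 in Z_n, where a_k is the modulus of
   the k-th coefficient of g (so a_0 = 0 and a is even).  Distributing each triple
   over its three entries with suitable weights, using
   a_l (a_j a_k) <= (t a_l^2 + (a_j a_k)^2 / t) / 2, and counting for each l the
   weights of the pairs (j, k) gives
   pi(g^3) <= 3 t (E(f) - s) + 3/4 s^2 / t.  With t = a the entropy is bounded by
   2 E(f) - (a - m)^3 (a + 3 m) / (6 a^2), and 0 <= m <= a.

   Sharpness.  For f = 1 + e cos(2 pi x / n) both sides are equal to leading order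
   as e -> 0. *)

Set Implicit Arguments.
Unset Strict Implicit.
Unset Printing Implicit Defensive.

Import Order.TTheory GRing.Theory Num.Theory numFieldNormedType.Exports.
(* [complex_scope] comes first so that [z^*] is [Num.conj]. *)
Local Open Scope complex_scope.
Local Open Scope ring_scope.

(** * Bounds on the logarithm *)

(* The difference of the two sides has derivative [(x - 1) ^+ 3 / (3 * x ^+ 3)]. *)
Lemma ln_le_rational (R : realType) (x : R) : 0 < x ->
  ln x <= x / 3 + 1 / 2 - x^-1 + x^-1 ^+ 2 / 6.
Proof.
move=> x0.
pose phi (y : R) : R := 3^-1 * y - y^-1 + 6^-1 * (y^-1 * y^-1) - ln y.
pose dphi (y : R) : R := (y - 1) ^+ 3 / (3 * y ^+ 3).
have dphiE (y : R) : 0 < y -> is_derive y (1 : R) phi (dphi y).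
  move=> y0; have yn0 : y != 0 by rewrite gt_eqF.
  have dl := is_derive1_ln y0.
  have dV := is_deriveV (f := id) yn0 (is_derive_id y (1 : R)).
  apply: is_derive_eq (is_deriveB (is_deriveD (is_deriveB (is_deriveZ _ _) dV)
    (is_deriveZ _ (is_deriveM dV dV))) dl) _.
  by rewrite /dphi /GRing.scale /=; field.
have phi1 : phi 1 = - (1 / 2) by rewrite /phi ln1 invr1; lra.
(* The constant 1 / 2 in the bound makes it an equality at 1. There [phi] has its minimum, since
   [dphi y] has the sign of [y - 1], so the mean value theorem is applied on either side of 1. *)
suff : phi 1 <= phi x by rewrite phi1 /phi expr2; lra.
have cphi a b : 0 < a -> {within `[a, b], continuous phi}%classic.
  move=> a0; apply: derivable_within_continuous => y /[!in_itv]/= /andP[ay _].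
  by have [] := dphiE y (lt_le_trans a0 ay).
have [x1|x1] := leP 1 x.
  have [c|c] := @MVT_segment _ phi dphi _ _ x1 _ (cphi _ _ ltr01).
    by rewrite in_itv /= => /andP[c1 _]; apply: dphiE; lra.
  rewrite in_itv /= => /andP[c1 _] e; rewrite -subr_ge0 e mulr_ge0 ?subr_ge0 //.
  by rewrite divr_ge0 ?exprn_ge0 ?mulr_ge0 ?exprn_ge0 ?subr_ge0 //; lra.
have [c|c] := @MVT_segment _ phi dphi _ _ (ltW x1) _ (cphi _ _ x0).
  by rewrite in_itv /= => /andP[c1 _]; apply: dphiE; lra.
rewrite in_itv /= => /andP[c1 c2] e; rewrite -subr_le0 e mulr_le0_ge0 ?subr_ge0 ?(ltW x1) //.
have c0 : 0 < c by lra.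
rewrite pmulr_lle0 ?invr_gt0 ?mulr_gt0 ?exprn_gt0 //.
by rewrite exprS mulr_le0_ge0 ?sqr_ge0 ?subr_le0.
Qed.

(** This is [ln_le_rational] multiplied by [2 * x ^+ 2], which clears the denominators. At 0 the
    left side is 0 and the right side is 1 / 3. *)
Lemma sqr_ln_sqr_le (R : realType) (x : R) : 0 <= x ->
  x ^+ 2 * ln (x ^+ 2) <= 2 / 3 * x ^+ 3 + x ^+ 2 - 2 * x + 1 / 3.
Proof.
rewrite le_eqVlt => /predU1P[<-|x0]; first by rewrite !expr0n /= mul0r; lra.
rewrite lnXn // mulr2n.
have -> : 2 / 3 * x ^+ 3 + x ^+ 2 - 2 * x + 1 / 3 =
    x ^+ 2 * (2 * (x / 3 + 1 / 2 - x^-1 + x^-1 ^+ 2 / 6)) by field; rewrite gt_eqF.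
by apply: ler_wpM2l; [exact: sqr_ge0 | have := ln_le_rational x0; lra].
Qed.

(* [ln_le_rational] applied to [(1 + t)^-1]. *)
Lemma sqr_ln_sqr_ge (R : realType) (t : R) : -1 < t ->
  2 * t + 3 * t ^+ 2 + 2 / 3 * t ^+ 3 - t ^+ 4 / 3 <= (1 + t) ^+ 2 * ln ((1 + t) ^+ 2).
Proof.
move=> t1; have x0 : 0 < 1 + t by lra.
rewrite lnXn // mulr2n.
have -> : 2 * t + 3 * t ^+ 2 + 2 / 3 * t ^+ 3 - t ^+ 4 / 3 =
  (1 + t) ^+ 2 * (- 2 * ((1 + t)^-1 / 3 + 1 / 2 - (1 + t) + (1 + t) ^+ 2 / 6)).
  by field; rewrite gt_eqF.
apply: ler_wpM2l; first exact: sqr_ge0.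
have xV0 : 0 < (1 + t)^-1 by rewrite invr_gt0.
by have := ln_le_rational xV0; rewrite invrK lnV //; lra.
Qed.

(** * Weighted triples in Z_n *)

(** For [j, k < n]: the representatives of least absolute value are nonzero and have the same sign.
    Neither 0 nor the self-opposite residue n / 2 lies in a half. *)
Definition same_half n (j k : nat) :=
  (0 < j.*2 < n)%N && (0 < k.*2 < n)%N || (n < j.*2)%N && (n < k.*2)%N.

(* A weight on the triples [j + k + l = 0] in Z_n.  Up to sign such a triple of
   nonzero residues of least absolute value either has one entry (here [l])
   balancing two of the opposite sign, or is a wrap-around triple whose absolute
   values sum to [n]; in the latter case the weight [(psi l - 1) / (n - 3)] is the
   share of [l] in [(psi j - 1) + (psi k - 1) + (psi l - 1) = n - 3].  Hence the
   three cyclic shifts of a triple carry total weight at least 1. *)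
Definition weight (R : realFieldType) n (j k l : nat) : R :=
  if same_half n j k then
    if same_half n k l then ((word_length n l)%:R - 1) / (n%:R - 3) else 1
  else 0.

(** Three representatives below [n.+2] whose sum is a multiple of [n.+2] leave only the quotients 0,
    1 and 2. This turns identities in Z_n into facts on naturals that [lia] can use. *)
Lemma Zp_sum0 n (j k : 'Z_n.+2) :
  (j + k + (- (j + k))%R = 0 \/ j + k + (- (j + k))%R = n.+2 \/
   j + k + (- (j + k))%R = n.+2.*2)%N.
Proof.
set l := (- (j + k))%R.
have dl : (n.+2 %| j + k + l)%N.
  have : (j + k + l)%R = 0 by rewrite addrN.
  move/(congr1 val) => /= /eqP; rewrite /dvdn.
  by rewrite [X in X == _ -> _]modnDml.
have [hj hk hl] : [/\ j < n.+2, k < n.+2 & l < n.+2]%N.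
  by split; apply: ltn_ord.
move/dvdnP: dl hj hk hl => [q]; move: (nat_of_ord j) (nat_of_ord k) (nat_of_ord l) => a b c.
case: q => [|[|[|q]]] E ha hb hc.
- by lia.
- by lia.
- by lia.
- by nia.
Qed.

Lemma sum_indicator_le (R : realFieldType) n (P : pred nat) a b :
  (forall i, (i < n)%N -> P i -> (a <= i < a + b)%N) ->
  \sum_(i < n) (P i)%:R <= b%:R :> R.
Proof.
move=> hP; rewrite -natr_sum ler_nat.
rewrite -(big_mkord xpredT (fun i => nat_of_bool (P i))) /index_iota subn0.
rewrite -big_mkcond /= sum1_count -size_filter -[X in (_ <= X)%N](size_iota a).
apply: uniq_leq_size; first by rewrite filter_uniq ?iota_uniq.
move=> i; rewrite mem_filter !mem_iota /= => /andP[Pi hi].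
by apply: hP.
Qed.

Lemma weight_ge0 (R : realFieldType) n j k l : (3 < n)%N -> (l < n)%N ->
  0 <= weight R n j k l.
Proof.
move=> hn hl; rewrite /weight; case: ifP => // jk; case: ifP => // kl.
have : (1 <= word_length n l)%N by move: kl; rewrite /same_half /word_length; lia.
rewrite -(ler_nat R) => h1; have : 4%:R <= n%:R :> R by rewrite ler_nat.
by move=> h4; apply: divr_ge0; lra.
Qed.

Lemma weight_le1 (R : realFieldType) n j k l : (3 < n)%N ->
  weight R n j k l <= (same_half n j k)%:R.
Proof.
move=> hn; rewrite /weight; case: ifP => // jk; case: ifP => // kl.
(* A word length is at most n / 2, hence at most n - 2 once n is at least 4; this keeps the
   wrap-around share at most 1. *)
have : (word_length n l + 2 <= n)%N by rewrite /word_length; lia.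
rewrite -(ler_nat R) natrD => h1; have : 4%:R <= n%:R :> R by rewrite ler_nat.
by move=> h4; rewrite ler_pdivrMr /=; lra.
Qed.

(** If all three entries lie in one half, their word lengths sum to n and the three shares sum to
    exactly 1. Otherwise exactly one pair shares a half, and the corresponding shift has weight
    1. *)
Lemma weight_cycle (R : realFieldType) n (j k l : nat) : (3 < n)%N ->
  (0 < j < n)%N -> (0 < k < n)%N -> (0 < l < n)%N ->
  (j + k + l = n \/ j + k + l = n.*2)%N ->
  1 <= weight R n j k l + weight R n k l j + weight R n l j k.
Proof.
move=> hn hj hk hl E.
have w0 a b c : (c < n)%N -> 0 <= weight R n a b c by exact: weight_ge0.
have := w0 j k l; have := w0 k l j; have := w0 l j k.
have [/andP[jk kl]|ndist] := boolP (same_half n j k && same_half n k l).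
  have lj : same_half n l j by move: jk kl; rewrite /same_half; lia.
  rewrite /weight jk kl lj => _ _ _.
  have : (word_length n j + word_length n k + word_length n l = n)%N.
    by move: jk kl lj E; rewrite /same_half /word_length; lia.
  move/(congr1 (fun i => i%:R : R)); rewrite !natrD => Ew.
  have h4 : 4%:R <= n%:R :> R by rewrite ler_nat.
  rewrite -!mulrDl ler_pdivlMr; lra.
rewrite /weight.
(* Pigeonhole on two halves; an entry equal to n / 2 forces the other two into a common half. *)
have : same_half n j k \/ same_half n k l \/ same_half n l j.
  by move: ndist E; rewrite /same_half; lia.
have trans : forall a b c, same_half n a b -> same_half n b c -> same_half n c a.
  by move=> a b c; rewrite /same_half; lia.
move: ndist (trans j k l) (trans k l j) (trans l j k).
case: (same_half n j k); case: (same_half n k l); case: (same_half n l j) => //=;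
  try by [move=> _ /(_ isT isT)|move=> _ _ /(_ isT isT)|move=> _ _ _ /(_ isT isT)|
          move=> _ _ _ _ []//; case].
all: by move=> _ _ _ _ _ _ _ _; lra.
Qed.

(** Let L be the word length of [l]. Weight 1 occurs when j and k lie in the half opposite to [l],
    for at most L - 1 values of j. Wrap-around triples occur for at most L values of j and
    contribute at most L (L - 1) / (n - 3), which is at most L - 1. *)
Lemma sum_weight_le (R : realFieldType) n (l : 'Z_n.+2) : (3 < n.+2)%N -> l != 0 ->
  \sum_(j : 'Z_n.+2) weight R n.+2 j (- (j + l))%R l <= 2 * ((word_length n.+2 l)%:R - 1).
Proof.
move=> hn l0; set N := n.+2.
have [c hc] : {c : nat | c = l} by exists l.
rewrite -hc.
have cN : (0 < c < N)%N by rewrite hc lt0n l0 ltn_ord.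
have h4 : 4%:R <= N%:R :> R by rewrite ler_nat.
have zs (j : 'Z_n.+2) : (j + c + (- (j + l))%R = 0 \/ j + c + (- (j + l))%R = N \/
    j + c + (- (j + l))%R = N.*2)%N by rewrite hc; exact: Zp_sum0.
have jN (j : 'Z_n.+2) : (j < N)%N by exact: ltn_ord.
have kN (j : 'Z_n.+2) : ((- (j + l))%R < N)%N by exact: ltn_ord.
(* When [l] is n / 2 no triple wraps around. A pair of positive weight has j different from 0 and n
   / 2, which leaves n - 2 = 2 (c - 1) values. *)
have [hN|hN] := eqVneq c.*2 N.
  have -> : 2 * ((word_length N c)%:R - 1) = (c - 1)%:R + (c - 1)%:R :> R.
    rewrite /word_length; have -> : (minn c (N - c) = c)%N by lia.
    by rewrite natrB; [lra | lia].
  pose P1 j := (0 < j < c)%N; pose P2 j := (c < j < N)%N.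
  apply: le_trans (_ : \sum_(j < N) ((P1 j)%:R + (P2 j)%:R) <= _).
    apply: ler_sum => j _; apply: le_trans (weight_le1 _ _ _ _ hn) _.
    rewrite -natrD ler_nat /same_half /P1 /P2; move: (jN j).
    by move: (nat_of_ord j) (nat_of_ord (- (j + l))%R) => a b; lia.
  rewrite big_split /=; apply: lerD.
    by apply: (@sum_indicator_le _ _ _ 1) => i iN; rewrite /P1; lia.
  by apply: (@sum_indicator_le _ _ _ c.+1) => i iN; rewrite /P2; lia.
pose L := word_length N c.
(* [P] contains the j of the triples of weight 1, [Q] those of the wrap-around triples; the two
   cases of each are the half in which [c] lies. *)
pose P j := if (c.*2 < N)%N then (N - c < j < N)%N else (0 < j < L)%N.
pose Q j := if (c.*2 < N)%N then (N - c.*2 < j.*2 < N)%N else (N < j.*2 < N + L.*2)%N.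
have L1 : (1 <= L)%N by rewrite /L /word_length; lia.
have L2 : (L = 1 \/ L <= N - 3)%N by rewrite /L /word_length; lia.
have L1R : 0 <= L%:R - 1 :> R by rewrite subr_ge0 ler1n.
pose v : R := (L%:R - 1) / (N%:R - 3).
have v0 : 0 <= v by apply: divr_ge0 => //; lra.
apply: le_trans (_ : \sum_(j < N) ((P j)%:R + (Q j)%:R * v) <= _).
  apply: ler_sum => j _; move: (jN j) (kN j) (zs j).
  move: (nat_of_ord j) (nat_of_ord (- (j + l))%R) => a b aN bN E.
  rewrite /weight; case: ifP => ab; last first.
    by apply: addr_ge0; [|apply: mulr_ge0]; rewrite ?ler0n.
  case: ifP => bl.
    have -> : Q a by move: ab bl; rewrite /Q /same_half /L /word_length; case: ifP; lia.
    by rewrite mul1r lerDr ler0n.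
  have -> : P a by move: ab bl; rewrite /P /same_half /L /word_length; case: ifP; lia.
  by rewrite lerDl; apply: mulr_ge0; rewrite ?ler0n.
rewrite big_split -mulr_suml /= mulrDl mul1r; apply: lerD.
  have -> : L%:R - 1 = (L - 1)%:R :> R by rewrite natrB.
  apply: (@sum_indicator_le _ _ _ (if (c.*2 < N)%N then N - c + 1 else 1)%N) => i iN.
  by rewrite /P /L /word_length; case: ifP; lia.
apply: (@le_trans _ _ (L%:R * v)).
  apply: ler_wpM2r => //.
  apply: (@sum_indicator_le _ _ _ (if (c.*2 < N)%N then (N.+1)./2 - c else N./2.+1)%N) => i iN.
  by rewrite /Q /L /word_length; case: ifP; lia.
rewrite /v mulrA ler_pdivrMr; last lra.
rewrite -/L mulrC; case: L2 => [->|L2]; first by rewrite mulr1n subrr !mul0r.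
by apply: ler_wpM2l => //; move: L2; rewrite -(ler_nat R) natrB //; lia.
Qed.

(** The constants come from the factor 3 of the cyclic averaging: 3 t = 3 (t / 2) 2, with 2 from
    [sum_weight_le], and 3 / (4 t) = 3 (1 / (2 t)) (1 / 2), with the last 1 / 2 from the evenness of
    [a]. *)
Lemma sum_convolution_le (R : realFieldType) n (a : 'Z_n.+2 -> R) (t : R) :
  (3 < n.+2)%N -> 0 < t ->
  (forall k, 0 <= a k) -> a 0 = 0 -> (forall k, a (- k) = a k) ->
  \sum_(j : 'Z_n.+2) \sum_(k : 'Z_n.+2) a j * a k * a (j + k) <=
    3 * t * (\sum_(k : 'Z_n.+2) ((word_length n.+2 k)%:R - 1) * a k ^+ 2)
    + 3 / 4 / t * (\sum_(k : 'Z_n.+2) a k ^+ 2) ^+ 2.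
Proof.
move=> hn t0 apos a0 aN.
pose w (p : 'Z_n.+2 * 'Z_n.+2) : R := weight R n.+2 p.1 p.2 (- (p.1 + p.2))%R.
pose X (p : 'Z_n.+2 * 'Z_n.+2) := a p.1 * a p.2 * a (- (p.1 + p.2)).
(* A pair (j, k) encodes the triple (j, k, l) of sum 0, and [r] is its cyclic shift to (k, l, j).
   The product [X] is invariant under [r], so [w] may be averaged over the three shifts. *)
pose r (p : 'Z_n.+2 * 'Z_n.+2) := (p.2, - (p.1 + p.2)).
have rl p : - ((r p).1 + (r p).2) = p.1.
  by rewrite [X in - X]addrC [X in - X]/(- (p.1 + p.2) + p.2) opprD opprK addrK.
have rI : injective r.
  move=> p q e; have e1 : p.1 = q.1 by rewrite -(rl p) e rl.
  have e2 : p.2 = q.2 by exact: (congr1 fst e).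
  by rewrite [p]surjective_pairing [q]surjective_pairing e1 e2.
have wrE p : w (r p) = weight R n.+2 p.2 (- (p.1 + p.2))%R p.1 by rewrite /w rl.
have wrrE p : w (r (r p)) = weight R n.+2 (- (p.1 + p.2))%R p.1 p.2.
  by rewrite wrE rl.
have Xr p : X (r p) = X p.
  by rewrite /X rl [LHS]mulrC mulrA.
have X0 p : 0 <= X p by rewrite !mulr_ge0.
have w0 p : 0 <= w p by apply: weight_ge0 => //; exact: ltn_ord.
have SE : \sum_(j : 'Z_n.+2) \sum_(k : 'Z_n.+2) a j * a k * a (j + k) = \sum_p X p.
  rewrite pair_big; apply: eq_bigr => -[j k] _ /=.
  by rewrite /X /= aN.
have S3 : \sum_p X p <= 3 * \sum_p w p * X p.
  have e1 : \sum_p w p * X p = \sum_p w (r p) * X p.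
    by rewrite (reindex_inj rI) /=; apply: eq_bigr => p _; rewrite Xr.
  have e2 : \sum_p w p * X p = \sum_p w (r (r p)) * X p.
    by rewrite e1 (reindex_inj rI) /=; apply: eq_bigr => p _; rewrite Xr.
  have -> : 3 * \sum_p w p * X p = \sum_p (w p + w (r p) + w (r (r p))) * X p.
    under [RHS]eq_bigr do rewrite !mulrDl.
    by rewrite !big_split /= -e1 -e2; ring.
  apply: ler_sum => p _.
  (* [weight_cycle] concerns nonzero entries; a triple with a zero entry has [X p = 0] because
     [a 0 = 0]. *)
  have [j0|j0] := eqVneq p.1 0; first by rewrite /X j0 a0 !mul0r mulr0.
  have [k0|k0] := eqVneq p.2 0; first by rewrite /X k0 a0 !(mul0r, mulr0).
  have [l0|l0] := eqVneq (- (p.1 + p.2)) 0; first by rewrite /X l0 a0 !mulr0.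
  rewrite -[leLHS]mul1r; apply: ler_wpM2r => //.
  rewrite wrE wrrE; apply: weight_cycle => //; try by rewrite lt0n ?j0 ?k0 ?l0 ltn_ord.
  case: (Zp_sum0 p.1 p.2) => // /eqP; rewrite !addn_eq0 -!andbA => /andP[p10 _].
  by case/negP: j0.
have amgm p : w p * X p <=
    t / 2 * (w p * a (- (p.1 + p.2)) ^+ 2) + 1 / 2 / t * (w p * (a p.1 ^+ 2 * a p.2 ^+ 2)).
  have -> : t / 2 * (w p * a (- (p.1 + p.2)) ^+ 2)
      + 1 / 2 / t * (w p * (a p.1 ^+ 2 * a p.2 ^+ 2)) =
      w p * X p + w p * (t * a (- (p.1 + p.2)) - a p.1 * a p.2) ^+ 2 / (2 * t).
    by rewrite /X; field; rewrite gt_eqF.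
  rewrite lerDl; apply: divr_ge0; last by rewrite mulr_ge0 ?ltW.
  by rewrite mulr_ge0 ?sqr_ge0.
have A1 : \sum_p w p * a (- (p.1 + p.2)) ^+ 2 <=
    2 * \sum_(k : 'Z_n.+2) ((word_length n.+2 k)%:R - 1) * a k ^+ 2.
  (* Reindexes the triples by q = (l, j), so that the inner sum for fixed l is that of
     [sum_weight_le]. *)
  pose h (q : 'Z_n.+2 * 'Z_n.+2) := (q.2, - (q.2 + q.1)).
  have hI : injective h.
    move=> [p1 p2] [q1 q2] /eqP; rewrite xpair_eqE /= => /andP[/eqP ->].
    by rewrite eqr_opp (inj_eq (addrI _)) => /eqP ->.
  have hE q : - ((h q).1 + (h q).2) = q.1.
    by rewrite [X in - X]/(q.2 - (q.2 + q.1)) opprB addrC addKr.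
  rewrite (reindex_inj hI).
  rewrite [leLHS](eq_bigr (fun q : 'Z_n.+2 * 'Z_n.+2 =>
    weight R n.+2 q.2 (- (q.2 + q.1))%R q.1 * a q.1 ^+ 2)).
    rewrite -(pair_big xpredT xpredT (fun l j : 'Z_n.+2 =>
      weight R n.+2 j (- (j + l))%R l * a l ^+ 2)) /= mulr_sumr.
    apply: ler_sum => l _; rewrite -mulr_suml mulrA.
    have [->|l0] := eqVneq l 0; first by rewrite a0 expr0n !mulr0.
    by apply: ler_wpM2r; [exact: sqr_ge0 | exact: sum_weight_le].
  by move=> q _; rewrite /w hE.
have A2 : \sum_p w p * (a p.1 ^+ 2 * a p.2 ^+ 2) <= 1 / 2 * (\sum_(k : 'Z_n.+2) a k ^+ 2) ^+ 2.
  (* [w (j, k)] and [w (- j, k)] are never both nonzero, while [a] is even. *)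
  pose h (q : 'Z_n.+2 * 'Z_n.+2) := (- q.1, q.2).
  have hI : injective h.
    by move=> [p1 p2] [q1 q2] /eqP; rewrite xpair_eqE /= eqr_opp => /andP[/eqP -> /eqP ->].
  have e1 : \sum_p w p * (a p.1 ^+ 2 * a p.2 ^+ 2) =
      \sum_p w (h p) * (a p.1 ^+ 2 * a p.2 ^+ 2).
    by rewrite (reindex_inj hI) /=; apply: eq_bigr => p _; rewrite aN.
  have e2 : (\sum_(k : 'Z_n.+2) a k ^+ 2) ^+ 2 = \sum_p (a p.1 ^+ 2 * a p.2 ^+ 2).
    rewrite expr2 mulr_suml; under eq_bigr do rewrite mulr_sumr.
    by rewrite pair_big.
  suff : \sum_p w p * (a p.1 ^+ 2 * a p.2 ^+ 2) +
      \sum_p w (h p) * (a p.1 ^+ 2 * a p.2 ^+ 2) <= (\sum_(k : 'Z_n.+2) a k ^+ 2) ^+ 2.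
    by rewrite -e1; lra.
  rewrite e2 -big_split; apply: ler_sum => p _.
  rewrite -[leRHS]mul1r.
  apply: le_trans (_ : (w p + w (h p)) * (a p.1 ^+ 2 * a p.2 ^+ 2) <= _).
    by rewrite mulrDl.
  apply: ler_wpM2r; first by rewrite mulr_ge0 ?sqr_ge0.
  apply: le_trans (lerD (weight_le1 _ _ _ _ hn) (weight_le1 _ _ _ _ hn)) _.
  (* The representatives of j and - j are both 0 or add up to [n.+2], so they never lie in the same
     half. *)
  have jE : (0 + p.1 + (- p.1)%R = 0 \/ 0 + p.1 + (- p.1)%R = n.+2 \/
      0 + p.1 + (- p.1)%R = n.+2.*2)%N by have := Zp_sum0 0 p.1; rewrite add0r.
  rewrite -natrD lern1 /same_half.
  move: jE (ltn_ord p.1 : p.1 < n.+2)%N (ltn_ord (- p.1)%R : (- p.1)%R < n.+2)%N.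
  have -> : (h p).1 = - p.1 by [].
  have -> : (h p).2 = p.2 by [].
  by move: (nat_of_ord p.1) (nat_of_ord (- p.1)%R) (nat_of_ord p.2) => x y z; lia.
rewrite SE; apply: le_trans S3 _.
have A3 : \sum_p w p * X p <= \sum_p
   (t / 2 * (w p * a (- (p.1 + p.2)) ^+ 2) + 1 / 2 / t * (w p * (a p.1 ^+ 2 * a p.2 ^+ 2))).
  by apply: ler_sum.
apply: le_trans (ler_wpM2l _ A3) _ => //.
rewrite big_split -!mulr_sumr mulrDr; apply: lerD.
  rewrite -!mulrA ler_pM2l // [leRHS](_ : _ = t * (2^-1 * (2 *
    \sum_(k : 'Z_n.+2) ((word_length n.+2 k)%:R - 1) * a k ^+ 2))).
    by rewrite !ler_pM2l ?invr_gt0.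
  by rewrite mulKf // pnatr_eq0.
rewrite [leRHS](_ : _ = 3 * (1 / 2 / t * (1 / 2 * (\sum_(k : 'Z_n.+2) a k ^+ 2) ^+ 2))).
  by rewrite ler_pM2l // ler_pM2l // !divr_gt0.
by field; rewrite gt_eqF.
Qed.

(** * Fourier coefficients *)

Section Expi.
Variable R : realType.
Implicit Types t u : R.

Lemma expiD t u : expi (t + u) = expi t * expi u.
Proof.
by rewrite /expi cosD sinD; apply/eqP; rewrite eq_complex /= eqxx /= addrC.
Qed.

Lemma expi0 : expi (0 : R) = 1.
Proof. by rewrite /expi cos0 sin0. Qed.

Lemma expiN t : expi (- t) = (expi t)^*.
Proof. by rewrite /expi cosN sinN. Qed.

Lemma conj_real_complex (x : R) : (x%:C)^* = x%:C.
Proof. exact: conjc_real. Qed.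

Lemma expi_conjK t : expi t * (expi t)^* = 1.
Proof. by rewrite -expiN -expiD subrr expi0. Qed.

Lemma expi_neq0 t : expi t != 0.
Proof.
apply/eqP => e; have /eqP := expi_conjK t.
by rewrite e mul0r eq_sym oner_eq0.
Qed.

Lemma expiX t m : expi (t * m%:R) = expi t ^+ m.
Proof.
elim: m => [|m IH]; first by rewrite mulr0 expi0.
by rewrite -addn1 natrD mulrDr mulr1 expiD IH addn1 exprSr.
Qed.

Lemma expi2pi : expi (2%:R * pi : R) = 1.
Proof. by rewrite mulr_natl /expi cos2pi sin2pi. Qed.

(** The real part suffices: cos t = 1 - 2 sin(t / 2)^2, and t / 2 lies strictly between 0 and pi. *)
Lemma expi_neq1 t : 0 < t < 2%:R * pi -> expi t != 1.
Proof.
move=> /andP[t0 tpi]; rewrite /expi eq_complex /= negb_and; apply/orP; left.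
have -> : t = (t / 2%:R) *+ 2 by rewrite -mulr_natr; lra.
rewrite cos_mulr2n cos2sin2.
have : 0 < sin (t / 2%:R) by apply: sin_gt0_pi; lra.
move=> s0; have := exprn_gt0 2 s0; set s := sin _ ^+ 2; lra.
Qed.

End Expi.

(* ['Z_n.+2] is convertible to ['I_n.+2], so that sums over residues and over
   frequencies [k < n.+2] range over the same type. *)
Section Fourier.
Variables (R : realType) (n : nat).
Let N := n.+2.
Implicit Types (f g : 'Z_n.+2 -> R) (j k x y : 'Z_n.+2).

Definition zeta : R[i] := expi (2%:R * pi / N%:R).

Lemma zetaXN : zeta ^+ N = 1.
Proof. by rewrite /zeta -expiX divfK ?expi2pi // pnatr_eq0. Qed.

Lemma zetaX_mod m : zeta ^+ (m %% N) = zeta ^+ m.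
Proof. by rewrite [in RHS](divn_eq m N) exprD mulnC exprM zetaXN expr1n mul1r. Qed.

Lemma zetaX_neq1 d : (0 < d < N)%N -> zeta ^+ d != 1.
Proof.
move=> /andP[d0 dN]; rewrite /zeta -expiX; apply: expi_neq1.
have N0 : 0 < N%:R :> R by rewrite ltr0n.
have p2 : 0 < 2%:R * pi :> R by rewrite mulr_gt0 ?pi_gt0.
rewrite mulr_gt0 ?divr_gt0 ?ltr0n //= mulrAC ltr_pdivrMr //.
by rewrite ltr_pM2l // ltr_nat.
Qed.

Lemma zetaX_conj m : zeta ^+ m * (zeta ^+ m)^* = 1.
Proof. by rewrite /zeta -expiX expi_conjK. Qed.

Lemma zeta_conj_inv m : (zeta ^+ m)^* = (zeta ^+ m)^-1.
Proof.
apply: (mulfI (_ : zeta ^+ m != 0)); first by rewrite /zeta -expiX expi_neq0.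
by rewrite zetaX_conj mulfV // /zeta -expiX expi_neq0.
Qed.

Lemma zeta_neq0 m : zeta ^+ m != 0.
Proof. by rewrite /zeta -expiX expi_neq0. Qed.

(** The exponents are products of natural representatives, and those of k and - k add up to 0 modulo
    [N]. *)
Lemma zetaX_opp k x : zeta ^+ ((- k)%R * x) = (zeta ^+ (k * x))^*.
Proof.
rewrite zeta_conj_inv; apply: (mulIf (zeta_neq0 (k * x))).
rewrite mulVf ?zeta_neq0 // -exprD -mulnDl exprM -zetaX_mod.
have -> : (((- k)%R + k) %% N = 0)%N by have /(congr1 val) := addNr k.
by rewrite expr0 expr1n.
Qed.

Lemma fourier_coefE (f : 'Z_n.+2 -> R[i]) (k : nat) :
  fourier_coef f k = mean (fun x => f x * (zeta ^+ (k * x))^*).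
Proof.
rewrite /fourier_coef /mean; congr (_ * _); apply: eq_bigr => x _.
rewrite expiN /zeta -expiX; congr (_ * (expi _)^*).
by rewrite [RHS]mulrAC natrM !mulrA.
Qed.

(** Orthogonality of characters: off the diagonal this is a geometric sum whose ratio [z] satisfies
    z^N = 1 and z != 1. *)
Lemma sum_zeta x y :
  \sum_(k < N) (zeta ^+ (k * x) * (zeta ^+ (k * y))^*) = (x == y)%:R * N%:R.
Proof.
pose z := zeta ^+ x * (zeta ^+ y)^*.
have zX (k : nat) : zeta ^+ (k * x) * (zeta ^+ (k * y))^* = z ^+ k.
  by rewrite /z exprMn !zeta_conj_inv exprVn -!exprM !(mulnC k).
under eq_bigr do rewrite zX.
have [xy|xy] := eqVneq x y.
  rewrite /z xy zetaX_conj mul1r.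
  by under eq_bigr do rewrite expr1n; rewrite sumr_const card_ord.
have zN : z ^+ N = 1.
  by rewrite -zX exprM zetaXN expr1n exprM zetaXN expr1n rmorph1 mulr1.
have z1 : z - 1 != 0.
  rewrite subr_eq0 /z zeta_conj_inv; apply/negP => /eqP e.
  have r0 m : zeta ^+ m != 0 by rewrite /zeta -expiX expi_neq0.
  have {e} e : zeta ^+ x = zeta ^+ y.
    by move: (congr1 ( *%R^~ (zeta ^+ y)) e); rewrite mul1r divfK.
  (* The exponent [y - x] is a truncated subtraction of naturals, so the order has to be fixed
     first. *)
  wlog lt : x y xy e {z zX zN} / (x < y)%N.
    move=> H; move: (xy); rewrite -val_eqE neq_ltn => /orP[|] lt.
      exact: (H x y).
    by apply: (H y x) => //; rewrite eq_sym.
  have /zetaX_neq1/negP[] : (0 < y - x < N)%N.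
    by rewrite subn_gt0 lt (leq_ltn_trans (leq_subr _ _) (ltn_ord y)).
  by apply/eqP/(mulfI (r0 x)); rewrite -exprD subnKC ?(ltnW lt) // mulr1.
by rewrite mul0r; apply: (mulfI z1); rewrite mulr0 -subrX1 zN subrr.
Qed.

Lemma fourier_inversion (f : 'Z_n.+2 -> R[i]) x :
  f x = \sum_(k < N) fourier_coef f k * zeta ^+ (k * x).
Proof.
under eq_bigr do rewrite fourier_coefE /mean -mulrA mulr_suml.
rewrite -mulr_sumr exchange_big /=.
rewrite (eq_bigr (fun y => f y * ((x == y)%:R * N%:R))); last first.
  move=> y _; rewrite -sum_zeta mulr_sumr; apply: eq_bigr => k _.
  by rewrite -mulrA [X in _ * X]mulrC.
rewrite (bigD1 x) //= eqxx big1 ?addr0 => [|y yx].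
  by rewrite mul1r mulrCA mulVf ?mulr1 // pnatr_eq0.
by rewrite eq_sym (negbTE yx) mul0r mulr0.
Qed.

Lemma mean_zeta (f : 'Z_n.+2 -> R) (k : nat) :
  mean (fun x => (f x)%:C * zeta ^+ (k * x)) = (fourier_coef (fun x => (f x)%:C) k)^*.
Proof.
rewrite fourier_coefE /mean rmorphM /= fmorphV rmorph_nat rmorph_sum /=.
congr (_ * _); apply: eq_bigr => x _.
by rewrite rmorphM /= conj_real_complex conjCK.
Qed.

Lemma mean_sum (I : finType) (h : I -> 'Z_n.+2 -> R[i]) :
  mean (fun x => \sum_i h i x) = \sum_i mean (h i).
Proof. by rewrite /mean exchange_big mulr_sumr. Qed.

Lemma eq_mean (K : fieldType) (g h : 'Z_n.+2 -> K) : g =1 h -> mean g = mean h.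
Proof. by move=> e; rewrite /mean; congr (_ * _); apply: eq_bigr => x _; rewrite e. Qed.

Lemma meanZ (K : fieldType) c (g : 'Z_n.+2 -> K) : mean (fun x => c * g x) = c * mean g.
Proof. by rewrite /mean mulrCA -mulr_sumr. Qed.

Lemma mean_real (f : 'Z_n.+2 -> R) : mean (fun x => (f x)%:C) = (mean f)%:C.
Proof. by rewrite /mean rmorphM /= fmorphV rmorph_nat rmorph_sum. Qed.

(** * Moduli of the Fourier coefficients of a real function *)

Definition amp (f : 'Z_n.+2 -> R) (k : nat) : R :=
  complex.Re `|fourier_coef (fun x => (f x)%:C) k|.

Lemma ampE (f : 'Z_n.+2 -> R) k : (amp f k)%:C = `|fourier_coef (fun x => (f x)%:C) k|.
Proof. by rewrite /amp RRe_real // normr_real. Qed.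

Lemma amp_ge0 f k : 0 <= amp f k.
Proof. by rewrite -ler0c ampE. Qed.

Lemma dirichlet_form_amp f :
  dirichlet_form (fun x => (f x)%:C) = \sum_(k < N) (word_length N k)%:R * amp f k ^+ 2.
Proof.
apply: complexI; rewrite dirichlet_formE mean_word_laplacian rmorph_sum /=.
by apply: eq_bigr => k _; rewrite rmorphM rmorphXn /= ampE rmorph_nat.
Qed.

(** Parseval: one factor f is expanded by inversion, and since f is real the other one produces the
    conjugate coefficient. *)
Lemma mean_sqr f : mean (fun x => f x ^+ 2) = \sum_(k < N) amp f k ^+ 2.
Proof.
apply: complexI; rewrite -mean_real rmorph_sum /=.
rewrite (eq_mean (h := fun x => \sum_(k < N)
   fourier_coef (fun x => (f x)%:C) k * ((f x)%:C * zeta ^+ (k * x)))); last first.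
  move=> x; rewrite expr2 rmorphM /= {2}(fourier_inversion (fun x => (f x)%:C) x).
  by rewrite mulr_sumr; apply: eq_bigr => k _; rewrite mulrCA.
rewrite mean_sum; apply: eq_bigr => k _.
by rewrite meanZ mean_zeta rmorphXn /= ampE sqr_normc.
Qed.

Lemma fourier_coef_mod (f : 'Z_n.+2 -> R[i]) (k : nat) :
  fourier_coef f (k %% N) = fourier_coef f k.
Proof.
rewrite !fourier_coefE; apply: eq_mean => x; congr (_ * _^*).
by rewrite exprM zetaX_mod -exprM.
Qed.

(** Expanding two of the three factors by inversion leaves the conjugate coefficient at j + k of the
    third; the triangle inequality then removes all phases. *)
Lemma mean_cube_le f :
  mean (fun x => f x ^+ 3) <=
    \sum_(j : 'Z_n.+2) \sum_(k : 'Z_n.+2) amp f j * amp f k * amp f (j + k)%R.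
Proof.
pose F := fourier_coef (fun x => (f x)%:C).
have E : (mean (fun x => f x ^+ 3))%:C =
    \sum_(j < N) \sum_(k < N) F j * (F k * (F (j + k)%N)^*).
  rewrite -mean_real.
  rewrite (eq_mean (h := fun x => \sum_(j < N) \sum_(k < N)
     F j * (F k * ((f x)%:C * zeta ^+ ((j + k) * x))))); last first.
    move=> x; rewrite !exprS expr0 mulr1 !rmorphM /=.
    rewrite mulrA {2}(fourier_inversion (fun x => (f x)%:C) x).
    rewrite {2}(fourier_inversion (fun x => (f x)%:C) x) -mulrA big_distrlr /= mulr_sumr.
    apply: eq_bigr => j _; rewrite mulr_sumr; apply: eq_bigr => k _.
    by rewrite mulnDl exprD /F; ring.
  rewrite mean_sum; apply: eq_bigr => j _.
  rewrite mean_sum; apply: eq_bigr => k _.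
  by rewrite !meanZ mean_zeta.
have norm3 (a b c : R[i]) : `|a * (b * c^*)| = `|a| * `|b| * `|c|.
  by rewrite !normrM norm_conjC mulrA.
rewrite -lecR; apply: le_trans (_ : `|(mean (fun x => f x ^+ 3))%:C| <= _).
  by rewrite real_ler_norm // complex_real.
rewrite E rmorph_sum /=; apply: le_trans (ler_norm_sum _ _ _) _.
apply: ler_sum => j _; rewrite rmorph_sum /=; apply: le_trans (ler_norm_sum _ _ _) _.
apply: ler_sum => k _; rewrite norm3 [leRHS](_ : _ = `|F j| * `|F k| * `|F (j + k)%R|).
  2: by rewrite !rmorphM /= !ampE.
(* The sum in the naturals and the sum in Z_n agree modulo [N], and coefficients are
   [N]-periodic. *)
have -> // : F (j + k)%N = F (j + k)%R by rewrite /F -fourier_coef_mod.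
Qed.

Lemma ampN f k : amp f (- k)%R = amp f k.
Proof.
apply: complexI; rewrite !ampE -[RHS]norm_conjC -mean_zeta fourier_coefE.
by congr `|_|; apply: eq_mean => x; rewrite zetaX_opp conjCK.
Qed.

Lemma amp0 f : amp f 0%N = `|mean f|.
Proof.
rewrite /amp fourier_coefE (eq_mean (h := fun x => (f x)%:C)); last first.
  by move=> x; rewrite mul0n expr0 rmorph1 mulr1.
by rewrite mean_real normc_def /= expr0n addr0 sqrtr_sqr.
Qed.

Lemma amp_addc f (c : R) k : k != 0 -> amp (fun x => f x + c) k = amp f k.
Proof.
move=> k0; congr complex.Re; congr `|_|.
rewrite !fourier_coefE.
have S : \sum_(x < N) (zeta ^+ (k * x))^* = 0.
  have := sum_zeta 0 k; rewrite eq_sym (negbTE k0) mul0r => e.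
  by rewrite -[RHS]e; apply: eq_bigr => x _; rewrite muln0 expr0 mul1r mulnC.
rewrite /mean; congr (_ * _).
under eq_bigr do rewrite rmorphD /= mulrDl.
by rewrite big_split /= -mulr_sumr S mulr0 addr0.
Qed.

Lemma amp_scale f (c : R) (k : nat) : 0 <= c -> amp (fun x => c * f x) k = c * amp f k.
Proof.
move=> c0; rewrite /amp fourier_coefE.
rewrite (eq_mean (h := fun x => c%:C * ((f x)%:C * (zeta ^+ (k * x))^*))); last first.
  by move=> x; rewrite rmorphM /= mulrA.
rewrite meanZ -fourier_coefE normrM ger0_norm ?ler0c //.
by case: `|_| => p q /=; rewrite mul0r subr0.
Qed.

Lemma meanD (K : fieldType) (g h : 'Z_n.+2 -> K) :
  mean (fun x => g x + h x) = mean g + mean h.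
Proof. by rewrite /mean big_split /= mulrDr. Qed.

Lemma mean_cst (K : numFieldType) (c : K) : mean (fun _ : 'Z_n.+2 => c) = c.
Proof.
rewrite /mean sumr_const card_ord -[c *+ _]mulr_natl mulrA.
by rewrite mulVf ?mul1r // pnatr_eq0.
Qed.

Lemma ler_mean f g : (forall x, f x <= g x) -> mean f <= mean g.
Proof.
by move=> fg; rewrite /mean ler_pM2l ?invr_gt0 ?ltr0n //; apply: ler_sum.
Qed.

Lemma dirichlet_form_ge0 f : 0 <= dirichlet_form (fun x => (f x)%:C).
Proof.
by rewrite dirichlet_form_amp; apply: sumr_ge0 => k _; rewrite mulr_ge0 ?sqr_ge0 ?ler0n.
Qed.

(** A constant changes only the coefficient at 0, whose word length is 0. *)
Lemma dirichlet_form_addc f (c : R) :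
  dirichlet_form (fun x => (f x + c)%:C) = dirichlet_form (fun x => (f x)%:C).
Proof.
rewrite (dirichlet_form_amp (fun x => f x + c)) dirichlet_form_amp.
apply: eq_bigr => k _; have [->|k0] := eqVneq k 0; last by rewrite amp_addc.
by rewrite /word_length min0n !mul0r.
Qed.

Lemma dirichlet_form_scale f (c : R) : 0 <= c ->
  dirichlet_form (fun x => (c * f x)%:C) = c ^+ 2 * dirichlet_form (fun x => (f x)%:C).
Proof.
move=> c0; rewrite (dirichlet_form_amp (fun x => c * f x)) dirichlet_form_amp mulr_sumr.
by apply: eq_bigr => k _; rewrite amp_scale // exprMn mulrCA.
Qed.

(** * The cosine as a test function *)

Definition cosZ x : R := cos (2%:R * pi / N%:R * (x : nat)%:R).

Lemma cosZE x : (cosZ x)%:C = 2%:R^-1 * (zeta ^+ x + (zeta ^+ x)^*).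
Proof. by rewrite /zeta -expiX addcJ mulKf ?pnatr_eq0. Qed.

Lemma amp_cosZ k : k != 1 -> k != - 1 -> amp cosZ k = 0.
Proof.
move=> k1 kN1; rewrite /amp fourier_coefE.
have E y : y != k -> \sum_(x < N) zeta ^+ (y * x) * (zeta ^+ (k * x))^* = 0.
  move=> yk; have := sum_zeta y k; rewrite (negbTE yk) mul0r => e.
  by rewrite -[RHS]e; apply: eq_bigr => x _; rewrite !(mulnC x).
rewrite (eq_mean (h := fun x => 2%:R^-1 * (zeta ^+ ((1%R : 'Z_n.+2) * x) * (zeta ^+ (k * x))^*
   + zeta ^+ ((- 1 : 'Z_n.+2)%R * x) * (zeta ^+ (k * x))^*))); last first.
  move=> x; rewrite zetaX_opp cosZE -mulrDl mulrA.
  by have -> : ((1%R : 'Z_n.+2) * x = x)%N by exact: mul1n.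
rewrite meanZ meanD /mean !E 1?eq_sym // !(mulr0, addr0) normr0 //.
Qed.

Lemma mean_cosZ : mean cosZ = 0.
Proof.
have := amp_cosZ (k := 0); rewrite amp0 eq_sym oner_eq0 eq_sym oppr_eq0 oner_eq0.
by move=> /(_ isT isT)/eqP; rewrite normr_eq0 => /eqP.
Qed.

(** The spectrum of the cosine lies in the frequencies 1 and N - 1, both of word length 1, so the
    energy reduces to Parseval's sum. *)
Lemma dirichlet_form_cosZ :
  dirichlet_form (fun x => (cosZ x)%:C) = mean (fun x => cosZ x ^+ 2).
Proof.
rewrite dirichlet_form_amp mean_sqr; apply: eq_bigr => k _.
have [->|k1] := eqVneq k 1.
  have -> : word_length N (1%R : 'Z_n.+2) = 1%N.
    by rewrite -[nat_of_ord 1%R]/1%N /word_length /N; lia.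
  by rewrite mul1r.
have [->|kN1] := eqVneq k (- 1); last by rewrite amp_cosZ // expr0n mulr0.
have -> : word_length N (- 1 : 'Z_n.+2)%R = 1%N; last by rewrite mul1r.
have -> : nat_of_ord (- 1 : 'Z_n.+2)%R = n.+1 by rewrite /= subSS subn0 modn_small.
by rewrite /word_length /N; lia.
Qed.

Lemma mean_cosZ_sqr_gt0 : 0 < mean (fun x => cosZ x ^+ 2).
Proof.
rewrite /mean mulr_gt0 ?invr_gt0 ?ltr0n // (bigD1 0) //=.
rewrite {1}/cosZ mulr0 cos0 expr1n ltr_wpDr ?ltr01 //.
by apply: sumr_ge0 => x _; exact: sqr_ge0.
Qed.

End Fourier.

(** * The logarithmic Sobolev inequality *)

Lemma dirichlet_form_sum_amp (R : realType) n (f : 'Z_n.+2 -> R) :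
  \sum_(k : 'Z_n.+2) ((word_length n.+2 k)%:R - 1) * amp f k ^+ 2 =
  dirichlet_form (fun x => (f x)%:C) - mean (fun x => f x ^+ 2).
Proof.
rewrite dirichlet_form_amp mean_sqr -sumrB.
by apply: eq_bigr => k _; rewrite mulrBl mul1r.
Qed.

Lemma mean_cube_centered_le (R : realType) n (g : 'Z_n.+2 -> R) (t : R) :
  (3 < n.+2)%N -> 0 < t -> mean g = 0 ->
  mean (fun x => g x ^+ 3) <=
    3 * t * (dirichlet_form (fun x => (g x)%:C) - mean (fun x => g x ^+ 2))
    + 3 / 4 / t * mean (fun x => g x ^+ 2) ^+ 2.
Proof.
move=> hn t0 g0; apply: le_trans (mean_cube_le g) _.
rewrite -dirichlet_form_sum_amp mean_sqr.
apply: sum_convolution_le => // [k||k]; first exact: amp_ge0.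
  by rewrite amp0 g0 normr0.
exact: ampN.
Qed.

Lemma entropy_sqr_le (R : realType) n (f : 'Z_n.+2 -> R) (a : R) :
  (forall x, 0 <= f x) -> 0 < a -> a ^+ 2 = mean (fun x => f x ^+ 2) ->
  entropy (fun x => f x ^+ 2) <=
    2 / 3 / a * mean (fun x => f x ^+ 3) + 4 / 3 * a ^+ 2 - 2 * a * mean f.
Proof.
move=> f0 a0 aE; rewrite /entropy -aE.
(* A pointwise majorant of [f x ^+ 2 * ln (f x ^+ 2)]: the bound at [f x / a], scaled back by
   [a ^+ 2]. In the mean its logarithmic term becomes a^2 ln(a^2), which the entropy subtracts. *)
pose h x := (ln (a ^+ 2) + 1) * f x ^+ 2 +
  (2 / 3 / a * f x ^+ 3 + ((- (2 * a)) * f x + a ^+ 2 / 3)).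
have fh x : f x ^+ 2 * ln (f x ^+ 2) <= h x.
  have := f0 x; rewrite le_eqVlt => /predU1P[fx|fx].
    by rewrite /h -fx !expr0n /= !(mul0r, mulr0) !add0r divr_ge0 ?sqr_ge0.
  have /sqr_ln_sqr_le : 0 <= f x / a by rewrite divr_ge0 // ltW.
  rewrite expr_div_n ln_div ?posrE ?exprn_gt0 // => H.
  have a2 : 0 < a ^+ 2 by rewrite exprn_gt0.
  have := ler_wpM2l (ltW a2) H.
  set l := ln (f x ^+ 2); set l' := ln (a ^+ 2).
  have -> : a ^+ 2 * (f x ^+ 2 / a ^+ 2 * (l - l')) = f x ^+ 2 * l - l' * f x ^+ 2.
    by field; rewrite gt_eqF.
  have -> : a ^+ 2 * (2 / 3 * (f x / a) ^+ 3 + f x ^+ 2 / a ^+ 2 - 2 * (f x / a) + 1 / 3)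
     = h x - l' * f x ^+ 2.
    by rewrite /h -/l'; field; rewrite gt_eqF.
  by rewrite lerD2r.
have := ler_mean fh; rewrite /h !meanD !meanZ mean_cst -aE; lra.
Qed.

Lemma log_sobolev (R : realType) n (f : 'Z_n.+2 -> R) :
  (3 < n.+2)%N -> (forall x, 0 <= f x) ->
  entropy (fun x => f x ^+ 2) <= 2 * dirichlet_form (fun x => (f x)%:C).
Proof.
move=> hn f0; set E := dirichlet_form _.
pose M := mean (fun x => f x ^+ 2).
have M0 : 0 <= M.
  rewrite -(mean_cst n (0 : R)); apply: ler_mean => x; exact: sqr_ge0.
(* If the mean square vanishes then so does f, and the entropy is 0; otherwise f can be normalised
   by [a]. *)
have := M0; rewrite le_eqVlt => /predU1P[Mz|Mpos].
  have fz x : f x ^+ 2 = 0.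
    move/esym/eqP: Mz; rewrite /M /mean mulf_eq0 invr_eq0 pnatr_eq0 /=.
    rewrite psumr_eq0 => [/allP/(_ x (mem_index_enum x))/eqP //|y _].
    exact: sqr_ge0.
  rewrite /entropy -/M -Mz mul0r subr0 (eq_mean (h := fun=> 0)).
    by rewrite mean_cst mulr_ge0 ?dirichlet_form_ge0.
  by move=> x; rewrite fz mul0r.
pose a := Num.sqrt M; have a0 : 0 < a by rewrite sqrtr_gt0.
have aE : a ^+ 2 = M by rewrite sqr_sqrtr.
apply: le_trans (entropy_sqr_le f0 a0 aE) _.
pose m := mean f; pose g x := f x + - m.
have m0 : 0 <= m by rewrite -(mean_cst n (0 : R)); apply: ler_mean.
have g0 : mean g = 0 by rewrite /g meanD mean_cst subrr.
have Eg : dirichlet_form (fun x => (g x)%:C) = E by exact: dirichlet_form_addc.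
pose s := mean (fun x => g x ^+ 2).
have s0 : 0 <= s.
  rewrite -(mean_cst n (0 : R)); apply: ler_mean => x; exact: sqr_ge0.
have sE : s = a ^+ 2 - m ^+ 2.
  rewrite /s (eq_mean (h := fun x => f x ^+ 2 + ((- (2 * m)) * f x + m ^+ 2))).
    by rewrite !meanD meanZ mean_cst aE -/m -/M; ring.
  by move=> x; rewrite /g; ring.
have := mean_cube_centered_le hn a0 g0; rewrite Eg -/s.
have -> : mean (fun x => g x ^+ 3) = mean (fun x => f x ^+ 3) - 3 * m * a ^+ 2 + 2 * m ^+ 3.
  rewrite (eq_mean (h := fun x => f x ^+ 3 + ((- (3 * m)) * f x ^+ 2 +
     ((3 * m ^+ 2) * f x + - m ^+ 3)))).
    by rewrite !meanD !meanZ mean_cst aE -/m -/M; ring.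
  by move=> x; rewrite /g; ring.
set c := mean _ => H.
have ma : m <= a by rewrite -(ler_pXn2r (n := 2)) ?nnegrE ?(ltW a0) // -subr_ge0 -sE.
(* Exact identity after inserting the largest value of [c] that [H] allows; the last summand is the
   slack, nonnegative because 0 <= m <= a. *)
have -> : 2 * E = 2 / 3 / a * (3 * a * (E - s) + 3 / 4 / a * s ^+ 2 + 3 * m * a ^+ 2 - 2 * m ^+ 3)
    + 4 / 3 * a ^+ 2 - 2 * a * m + (a - m) ^+ 3 * (a + 3 * m) / (6 * a ^+ 2).
  by rewrite sE; field; rewrite gt_eqF.
rewrite -[leLHS]addr0; apply: lerD; last first.
  apply: divr_ge0; last by rewrite mulr_ge0 ?sqr_ge0.
  by rewrite mulr_ge0 ?exprn_ge0 ?subr_ge0 //; lra.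
rewrite !lerD2r; apply: ler_wpM2l; last lra.
by rewrite !divr_ge0 // ltW.
Qed.

(** * Sharpness of the constant 2 *)

Lemma log_sobolev_sharp (R : realType) n (c : R) : c < 2 ->
  exists f : 'Z_n.+2 -> R, (forall x, 0 <= f x) /\
    c * dirichlet_form (fun x => (f x)%:C) < entropy (fun x => f x ^+ 2).
Proof.
move=> c2; pose d := 2 - c; have d0 : 0 < d by rewrite subr_gt0.
(* Here 2 e = d / (1 + d) is smaller than both d and 1: the first beats [c], the second makes f
   nonnegative. *)
pose e := d / (2 * (1 + d)).
have e0 : 0 < e by rewrite divr_gt0 // mulr_gt0 // addr_gt0.
have eE : e * (2 * (1 + d)) = d by rewrite divfK // gt_eqF // mulr_gt0 // addr_gt0.
have ed : 2 * e < d by nra.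
have e1 : 2 * e < 1 by nra.
pose u := @cosZ R n.
have uB x : -1 <= u x <= 1 by rewrite cos_geN1 cos_le1.
pose f x := e * u x + 1; exists f.
have f0 x : 0 <= f x by have := uB x; rewrite /f => /andP[]; nra.
split => //.
pose S := mean (fun x => u x ^+ 2).
have S0 : 0 < S by exact: mean_cosZ_sqr_gt0.
have S1 : S <= 1.
  rewrite -[leRHS](mean_cst n); apply: ler_mean => x.
  by have := uB x => /andP[]; nra.
have -> : dirichlet_form (fun x => (f x)%:C) = e ^+ 2 * S.
  by rewrite dirichlet_form_addc dirichlet_form_scale ?(ltW e0) // dirichlet_form_cosZ.
have mf : mean (fun x => f x ^+ 2) = 1 + e ^+ 2 * S.
  rewrite (eq_mean (h := fun x => e ^+ 2 * u x ^+ 2 + ((2 * e) * u x + 1))).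
    by rewrite !meanD !meanZ mean_cst mean_cosZ -/S; ring.
  by move=> x; rewrite /f; ring.
rewrite /entropy mf.
(* Since |u| <= 1, u^3 >= - u^2 and u^4 <= u^2; this turns the quartic lower bound into a quadratic
   one, whose mean involves only [S] because u has mean 0. *)
have hf x : (3 * e ^+ 2 - 2 / 3 * e ^+ 3 - e ^+ 4 / 3) * u x ^+ 2 + (2 * e) * u x <=
    f x ^+ 2 * ln (f x ^+ 2).
  have /andP[u1 u2] := uB x.
  have t1 : -1 < e * u x by nra.
  rewrite /f [e * _ + 1]addrC; apply: le_trans (sqr_ln_sqr_ge t1).
  have U2 : u x ^+ 2 <= 1 by nra.
  have h3 : 0 <= e ^+ 3 * (u x ^+ 2 * (1 + u x)).
    apply: mulr_ge0; first exact: exprn_ge0 (ltW e0).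
    by apply: mulr_ge0; [exact: sqr_ge0 | lra].
  have h4 : 0 <= e ^+ 4 * (u x ^+ 2 * (1 - u x ^+ 2)).
    apply: mulr_ge0; first exact: exprn_ge0 (ltW e0).
    by apply: mulr_ge0; [exact: sqr_ge0 | lra].
  rewrite -subr_ge0.
  have -> : forall v : R, 2 * (e * v) + 3 * (e * v) ^+ 2 + 2 / 3 * (e * v) ^+ 3 - (e * v) ^+ 4 / 3 -
      ((3 * e ^+ 2 - 2 / 3 * e ^+ 3 - e ^+ 4 / 3) * v ^+ 2 + 2 * e * v) =
      2 / 3 * (e ^+ 3 * (v ^+ 2 * (1 + v))) + 1 / 3 * (e ^+ 4 * (v ^+ 2 * (1 - v ^+ 2))).
    by move=> v; field.
  by lra.
have := ler_mean hf; rewrite meanD !meanZ mean_cosZ mulr0 addr0 -/S => H.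
have p0 : 0 < e ^+ 2 * S by rewrite mulr_gt0 ?exprn_gt0.
have L : (1 + e ^+ 2 * S) * ln (1 + e ^+ 2 * S) <= (1 + e ^+ 2 * S) * (e ^+ 2 * S).
  by apply: ler_wpM2l; [lra | apply: le_ln1Dx; lra].
(* As e^2 S <= e^2 <= e, the total loss is at most (2/3 + 1/3 + 1) e = 2 e, which is less than d. *)
have K : c < 2 - 2 / 3 * e - e ^+ 2 / 3 - e ^+ 2 * S.
  have eS : e ^+ 2 * S <= e ^+ 2 by rewrite ler_piMr ?sqr_ge0.
  have ee : e ^+ 2 <= e by rewrite expr2 ler_piMr ?(ltW e0) //; lra.
  have cd : c = 2 - d by rewrite /d subKr.
  by lra.
have := ltr_pM2r p0 => /(_ c (2 - 2 / 3 * e - e ^+ 2 / 3 - e ^+ 2 * S)); rewrite K; lra.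
Qed.

Theorem theorem1 (R : realType) (n : nat) (hn : (4 <= n)%N) :
  (forall f : 'Z_n -> R, (forall x, 0 <= f x) ->
     entropy (fun x => f x ^+ 2) <= 2%:R * dirichlet_form (fun x => (f x)%:C))
  /\
  (forall c : R, c < 2%:R ->
     exists f : 'Z_n -> R, (forall x, 0 <= f x) /\
       c * dirichlet_form (fun x => (f x)%:C) < entropy (fun x => f x ^+ 2)).
Proof.
case: n hn => [|[|n]] // hn; split=> [f f0|c c2]; first exact: log_sobolev.
exact: log_sobolev_sharp.
Qed.
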